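(* Let $(W,S)$ be a finitely generated Coxeter system such that $W$ acts geometrically on a CAT(0) space $X$. For $x\in X$ let $\Lambda_x$ be the copy of the Cayley graph of $(W,S)$ in $X$ at $x$, with $W$-equivariant map $P_x:\Lambda(W,S)\to\Lambda_x$. Then for each subset $A\subset S$, the subgroup $\langle A\rangle$ is quasi-convex in $X$, i.e. $P_x(\langle A\rangle)$ is quasi-convex in $X$.
   Context: A Coxeter system $(W,S)$ is a group $W$ with generating set $S$ and presentation $\langle S : (s_is_j)^{m(i,j)}\rangle$, where $m(i,j)=m(j,i)\in\{1,2,\ldots,\infty\}$, $m(i,j)=1$ iff $i=j$, and the relation is omitted if $m(i,j)=\infty$; it is finitely generated if $S$ is finite. The Cayley graph $\Lambda(W,S)$ has vertex set $W$ and, for each $w\in W$, $s\in S$, a single edge of length 1 joining $w$ and $ws$. For $A\subset S$, $\langle A\rangle$ is the subgroup of $W$ generated by $A$, regarded also as a set of vertices of $\Lambda(W,S)$. A group acts geometrically on a space if the action is properly discontinuous, cocompact and by isometries. CAT(0) spaces are taken to be proper complete geodesic metric spaces satisfying the CAT(0) inequality. $\Lambda_x\subset X$ has vertex set the orbit $Wx$ and a CAT(0) geodesic edge connecting $w_1x$ and $w_2x$ ($w_1,w_2\in W$) whenever $w_1s=w_2$ for some $s\in S$; $P_x$ is the $W$-equivariant map with $P_x(w)=wx$ on vertices which maps each edge of $\Lambda(W,S)$ onto the corresponding CAT(0) geodesic; so $P_x(\langle A\rangle)=\langle A\rangle x$. A subset $Y\subset X$ is quasi-convex if there is a constant $K$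 such that every CAT(0) geodesic in $X$ joining two points of $Y$ lies in the $K$-neighborhood of $Y$. *)

(* Defs.v *)
From HB Require Import structures.
From mathcomp Require Import all_boot all_order all_algebra.
From mathcomp Require Import all_classical all_reals all_analysis.

Set Implicit Arguments.
Unset Strict Implicit.
Unset Printing Implicit Defensive.

Import Order.TTheory GRing.Theory Num.Theory.

Local Open Scope classical_set_scope.
Local Open Scope ring_scope.

Section Presentations.
Variable I : Type.

(* The letter (i, false) stands for the generator i, and (i, true) for its
   formal inverse. *)
Definition word := seq (I * bool).

(* The congruence on words whose quotient is the group < I | rel >. *)
Inductive pres_eq (rel : set word) : word -> word -> Prop :=
| pres_refl u : pres_eq rel u u
| pres_sym u v : pres_eq rel u v -> pres_eq rel v u
| pres_trans u v w : pres_eq rel u v -> pres_eq rel v w -> pres_eq rel u w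
| pres_free u i b v : pres_eq rel (u ++ [:: (i, b); (i, ~~ b)] ++ v) (u ++ v)
| pres_rel u r v : rel r -> pres_eq rel (u ++ r ++ v) (u ++ v).

Definition eval_word (G : groupType) (g : I -> G) (u : word) : G :=
  (\prod_(l <- u) (if l.2 then (g l.1)^-1 else g l.1))%g.

Definition has_presentation (G : groupType) (g : I -> G) (rel : set word) :=
  (forall x : G, exists u, x = eval_word g u) /\
  (forall u v, eval_word g u = eval_word g v <-> pres_eq rel u v).

(* m i j = None encodes m(i,j) = oo. *)
Definition coxeter_matrix (m : I -> I -> option nat) :=
  [/\ forall i j, m i j = m j i,
      forall i j, m i j <> Some 0%N &
      forall i j, m i j = Some 1%N <-> i = j].

Definition coxeter_relators (m : I -> I -> option nat) : set word :=
  [set r | exists i j k, m i j = Some k /\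
    r = flatten (nseq k [:: (i, false); (j, false)])].

End Presentations.

Definition coxeter_system (W : groupType) (S : set W) :=
  exists m : S -> S -> option nat,
    coxeter_matrix m /\
    has_presentation (fun s : S => \val s) (coxeter_relators m).

Definition subgroup_set (W : groupType) (H : set W) := group_closed (mem H).

Definition generated (W : groupType) (A : set W) : set W :=
  smallest (@subgroup_set W) A.

Section CayleyGraph.
Variables (R : realType) (W : groupType).

(* The Cayley graph is realized geometrically inside W -> R by barycentric
   coordinates; thus the edges from w to ws and from ws to wss = w coincide. *)
Definition vertex (w : W) : W -> R := fun v => (v == w)%:R.

Definition edge_point (w w' : W) (t : R) : W -> R :=
  fun v => (1 - t) * vertex w v + t * vertex w' v.

Definition edge (w w' : W) : set (W -> R) := edge_point w w' @` `[0, 1].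

Definition cayley_graph (S : set W) : set (W -> R) :=
  range vertex `|` \bigcup_(w in setT) \bigcup_(s in S) edge w (w * s)%g.

Definition translate (g : W) (b : W -> R) : W -> R := fun v => b (g^-1 * v)%g.

End CayleyGraph.

Section Metric.
Variables (R : realType) (X : metricType R).
Implicit Types (x y : X) (c : R -> X).

Definition geodesic x y c :=
  [/\ c 0 = x, c (mdist x y) = y &
      {in `[0, mdist x y] &, forall s t, mdist (c s) (c t) = `|s - t|}].

Definition geodesic_image x y c : set X := c @` `[0, mdist x y].

Definition geodesic_space := forall x y, exists c, geodesic x y c.

Definition proper_space := forall x (r : R), compact [set y | mdist x y <= r].

Definition complete_space :=
  forall F : set_system X, ProperFilter F -> cauchy F -> exists l : X, F --> l.

Definition plane_dist (p q : R * R) : R :=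
  Num.sqrt ((p.1 - q.1) ^+ 2 + (p.2 - q.2) ^+ 2).

(* The point of the segment [p, q] at distance s from p, where l is the length
   of [p, q]; for l = 0 = s it is p, as s / 0 = 0. *)
Definition plane_point (p q : R * R) (l s : R) : R * R :=
  (p.1 + s / l * (q.1 - p.1), p.2 + s / l * (q.2 - p.2)).

(* v and c are the vertices and sides of a geodesic triangle, the i-th side
   going from the i-th vertex to the next one (cyclically), and v' are the
   vertices of a comparison triangle. *)
Definition cat0_inequality :=
  forall (v : 'I_3 -> X) (c : 'I_3 -> R -> X) (v' : 'I_3 -> R * R),
    let len i := mdist (v i) (v (ordS i)) in
    let compar i s := plane_point (v' i) (v' (ordS i)) (len i) s in
    (forall i, geodesic (v i) (v (ordS i)) (c i)) ->
    (forall i j, plane_dist (v' i) (v' j) = mdist (v i) (v j)) ->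
    forall i j (s t : R), s \in `[0, len i] -> t \in `[0, len j] ->
      mdist (c i s) (c j t) <= plane_dist (compar i s) (compar j t).

Definition cat0_space :=
  [/\ proper_space, complete_space, geodesic_space & cat0_inequality].

Definition quasi_convex (Y : set X) :=
  exists K : R, forall x y c, Y x -> Y y -> geodesic x y c ->
    geodesic_image x y c `<=` \bigcup_(z in Y) ball z K.

Section Actions.
Variables (W : groupType) (act : W -> X -> X).

Definition group_action :=
  (forall x, act 1%g x = x) /\
  (forall g h x, act (g * h)%g x = act g (act h x)).

Definition isometric_action :=
  forall g x y, mdist (act g x) (act g y) = mdist x y.

Definition properly_discontinuous :=
  forall K : set X, compact K ->
    finite_set [set g | (act g @` K) `&` K !=set0].

Definition cocompact :=
  exists2 K : set X, compact K & \bigcup_(g in setT) (act g @` K) = setT.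

Definition geometric_action :=
  [/\ group_action, isometric_action, properly_discontinuous & cocompact].

Definition cayley_copy (S : set W) (x : X) : set X :=
  range (act^~ x) `|`
  [set p | exists w s c, [/\ S s, geodesic (act w x) (act (w * s)%g x) c &
                             geodesic_image (act w x) (act (w * s)%g x) c p]].

(* Only the values of P on cayley_graph S matter. *)
Definition cayley_copy_map (S : set W) (x : X) (P : (W -> R) -> X) :=
  [/\ set_fun (cayley_graph S) (cayley_copy S x) P,
      forall g b, cayley_graph S b -> P (translate g b) = act g (P b),
      forall w, P (vertex R w) = act w x &
      forall w s, S s ->
        exists2 c, geodesic (act w x) (act (w * s)%g x) c &
          P @` edge w (w * s)%g =
          geodesic_image (act w x) (act (w * s)%g x) c].

End Actions.
End Metric.

(* Main.v *)
(* Let an orbit point gx be close to a geodesic joining two points of <A>x, and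
   let b be a shortest element of <A>g. After a translation by <A> we may assume
   g = b. The reflections r_1, ..., r_n of the walls crossed by a shortest word
   for b are distinct and not in <A>, so each of their walls has <A> on one side
   and b on the other. Hence an orbit path that tracks the geodesic crosses each
   wall both before and after b, and there r_i moves the geodesic by a bounded
   amount; since displacement functions of isometries are convex in a CAT(0)
   space, r_i moves bx by a bounded amount. So the n distinct elements
   b^-1 r_i b lie in a finite set that does not depend on g, which bounds n, the
   distance from g to <A>. *)
Require Import Defs.
From mathcomp Require Import all_boot all_order all_algebra.
From mathcomp Require Import all_classical all_reals all_analysis.
From mathcomp Require Import ring lra zify.

Set Implicit Arguments.
Unset Strict Implicit.
Unset Printing Implicit Defensive.

Import Order.TTheory GRing.Theory Num.Theory.

Local Open Scope classical_set_scope.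

(** * Reflections and walls *)

Section Words.
Variable W : groupType.
Local Open Scope group_scope.
Implicit Types (g h r s : W) (u v : seq W) (H : set W).

Definition wprod u : W := \prod_(s <- u) s.

Lemma wprod_cons s u : wprod (s :: u) = s * wprod u.
Proof. by rewrite /wprod big_cons. Qed.

Lemma wprod_cat u v : wprod (u ++ v) = wprod u * wprod v.
Proof. by rewrite /wprod big_cat. Qed.

Definition letters_in (S : set W) u := forall s, s \in u -> S s.

Lemma letters_in_cons (S : set W) s u :
  letters_in S (s :: u) <-> S s /\ letters_in S u.
Proof.
split=> [Su|[Ss Su] t]; first split.
- by apply: Su; rewrite mem_head.
- by move=> t tu; apply: Su; rewrite inE tu orbT.
- by rewrite inE => /orP[/eqP ->|/Su].
Qed.

Lemma letters_in_cat (S : set W) u v :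
  letters_in S u -> letters_in S v -> letters_in S (u ++ v).
Proof. by move=> Su Sv s; rewrite mem_cat => /orP[/Su|/Sv]. Qed.

(* The reflections [r] such that the path spelled [u] from [g] in the Cayley
   graph crosses an edge flipped by [r], listed along the path. *)
Fixpoint refls g u : seq W :=
  if u is s :: u' then g * s * g^-1 :: refls (g * s) u' else [::].

Lemma size_refls g u : size (refls g u) = size u.
Proof. by elim: u g => //= s u IH g; rewrite IH. Qed.

Lemma refls_cat g u v : refls g (u ++ v) = refls g u ++ refls (g * wprod u) v.
Proof.
elim: u g => /= [|s u IH] g; first by rewrite /wprod big_nil mulg1.
by rewrite IH wprod_cons mulgA.
Qed.

Lemma refls_prefix r g u : r \in refls g u ->
  exists p s q, u = p ++ s :: q /\ r = g * wprod p * s * (g * wprod p)^-1.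
Proof.
elim: u g => //= s u IH g; rewrite inE => /orP[/eqP ->|/IH].
  by exists [::], s, u; rewrite /wprod big_nil mulg1.
move=> [p [t [q [-> ->]]]]; exists (s :: p), t, q.
by rewrite wprod_cons !mulgA.
Qed.

Lemma subgroup_set1 H : subgroup_set H -> H 1.
Proof. by case; rewrite inE. Qed.

Lemma subgroup_setV H : subgroup_set H -> forall g, H g -> H g^-1.
Proof.
by move=> /group_closedV HV g Hg; have := HV g; rewrite !inE; apply.
Qed.

Lemma subgroup_setM H : subgroup_set H -> forall g h, H g -> H h -> H (g * h).
Proof.
by move=> /group_closedM HM g h Hg Hh; have := HM g h; rewrite !inE; apply.
Qed.

Lemma subgroup_wprod H u : subgroup_set H -> letters_in H u -> H (wprod u).
Proof.
move=> sH; elim: u => [|s u IH].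
  by move=> _; rewrite /wprod big_nil; apply: subgroup_set1.
by move=> /letters_in_cons[Hs /IH Hu]; rewrite wprod_cons; apply: subgroup_setM.
Qed.

Lemma subgroup_refls H r g u : subgroup_set H -> H g -> letters_in H u ->
  r \in refls g u -> H r.
Proof.
move=> sH Hg Hu /refls_prefix[p [s [q [def_u ->]]]].
have Hgp : H (g * wprod p).
  apply: subgroup_setM => //; apply: subgroup_wprod => // t tp.
  by apply: Hu; rewrite def_u mem_cat tp.
have Hs : H s by apply: Hu; rewrite def_u mem_cat mem_head orbT.
by do 2?apply: subgroup_setM => //; apply: subgroup_setV.
Qed.

Lemma generated_subgroup (A : set W) : subgroup_set (generated A).
Proof.
split=> [|g h]; rewrite !inE; first by move=> H /= [[/[!inE]]].
move=> Ag Ah H /= [[H1 HB] AH].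
by have := HB g h; rewrite !inE; apply; [apply: Ag|apply: Ah].
Qed.

Section Involutions.
Variable S : set W.
Hypothesis S_sq : forall s, S s -> s * s = 1.

Lemma wprod_rev u : letters_in S u -> wprod (rev u) = (wprod u)^-1.
Proof.
elim: u => [|s u IH]; first by rewrite /wprod big_nil invg1.
move=> /letters_in_cons[Ss /IH]; rewrite wprod_cons invgM rev_cons => <-.
by rewrite -cats1 wprod_cat /wprod big_seq1 (mulg1_eq (S_sq Ss)).
Qed.

Lemma generated_word (A : set W) g : A `<=` S -> generated A g ->
  exists2 u, letters_in A u & g = wprod u.
Proof.
move=> AS; apply: (@smallest_sub _ (@subgroup_set W) A
  [set g | exists2 u, letters_in A u & g = wprod u]); last first.
  move=> s As; exists [:: s]; last by rewrite /wprod big_seq1.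
  by move=> t; rewrite inE => /eqP ->.
split=> [|a b]; rewrite !inE /=; first by exists [::]; rewrite /wprod ?big_nil.
move=> [u Au ->] [v Av ->]; exists (u ++ rev v).
  by apply: letters_in_cat => // t; rewrite mem_rev; apply: Av.
by rewrite wprod_cat wprod_rev// => s /Av/AS.
Qed.

(** Deletion: [r] is [h s h^-1] with [h] the vertex where the path reaches the flipped edge.
    Multiplying by [r] puts a second [s] next to the first, and the two cancel. *)
Lemma refls_delete r g u : letters_in S u -> r \in refls g u ->
  exists v, [/\ letters_in S v, size v < size u & r * (g * wprod u) = g * wprod v].
Proof.
move=> Su /refls_prefix[p [s [q [def_u ->]]]]; exists (p ++ q); split.
- move=> t; rewrite mem_cat => tpq; apply: Su.
  by rewrite def_u mem_cat inE orbCA tpq orbT.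
- by rewrite def_u !size_cat addnS.
- rewrite def_u !wprod_cat wprod_cons -!mulgA; congr (_ * (_ * _)).
  rewrite invgM -!mulgA mulKg mulKg mulgA S_sq ?mul1g//.
  by apply: Su; rewrite def_u mem_cat mem_head orbT.
Qed.

(** A shortest path crosses no wall twice: if the first reflection recurred, deleting its second
    occurrence and cancelling the first letter would give a shorter word. *)
Lemma refls_uniq g u : letters_in S u ->
  (forall v, letters_in S v -> wprod v = wprod u -> size u <= size v) ->
  uniq (refls g u).
Proof.
elim: u g => //= s u IH g /letters_in_cons[Ss Su] minu; apply/andP; split.
  apply/negP => /(refls_delete Su)[v [Sv vu]].
  rewrite -!mulgA mulKg (mulgA s s) S_sq// mul1g => /mulgI def_u.
  have := minu v Sv; rewrite wprod_cons def_u mulgA S_sq// mul1g => /(_ erefl).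
  by rewrite leqNgt ltnW.
apply: IH => // v Sv vu.
have /minu : letters_in S (s :: v) by apply/letters_in_cons.
by rewrite !wprod_cons vu /= ltnS; apply.
Qed.

End Involutions.

(** The reflections along the relator are [c 0], ..., [c (2k-1)]. Since [(s t)^k = 1], [c] has
    period [k], so the list is one block of length [k] repeated twice. *)
Lemma odd_count_refls_relator r g s t k : s * s = 1 -> t * t = 1 ->
  (s * t) ^+ k = 1 -> ~~ odd (count_mem r (refls g (flatten (nseq k [:: s; t])))).
Proof.
move=> ss tt stk; pose c i := g * (s * t) ^+ i * s * g^-1.
have sV : s^-1 = s by exact: mulg1_eq.
have tV : t^-1 = t by exact: mulg1_eq.
(* Conjugation by [s] inverts [s t]; this brings both the [s]-steps and the [t]-steps of the path to
   the form [c n]. *)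
have sX i : (s * t) ^+ i * s * (s * t) ^+ i = s.
  elim: i => [|i IH]; first by rewrite expg0 mul1g mulg1.
  rewrite {1}expgSr expgS -[in RHS]IH !mulgA.
  by rewrite -(mulgA _ s s) ss mulg1 -(mulgA _ t t) tt mulg1.
have Xs i : s * ((s * t) ^+ i)^-1 = (s * t) ^+ i * s.
  by apply: (@mulIg _ ((s * t) ^+ i)); rewrite mulgVK sX.
have reflsX j i : refls (g * (s * t) ^+ i) (flatten (nseq j [:: s; t])) =
    [seq c n | n <- iota i.*2 j.*2].
  elim: j i => //= j IH i.
  have -> : g * (s * t) ^+ i * s * t = g * (s * t) ^+ i.+1.
    by rewrite expgSr !mulgA.
  rewrite IH /c doubleS; congr [:: _, _ & _].
    by rewrite -addnn expgnDr invgM -!mulgA (mulgA s) Xs !mulgA.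
  by rewrite -addnn -addSn expgnDr expgSr !invgM sV -!mulgA (mulgA s (_ ^- _)) Xs !mulgA.
have /= := reflsX k 0; rewrite expg0 mulg1 => ->.
rewrite double0 -(addnn k) iotaD map_cat count_cat add0n -{2}(addn0 k) iotaDl -map_comp.
have cDk : c \o addn k =1 c by move=> i; rewrite /c /= expgnDr stk mul1g.
by rewrite (eq_map cDk) addnn odd_double.
Qed.

End Words.

Section Separation.
Variables (W : groupType) (S : set W).
Hypothesis hS : coxeter_system S.
Local Open Scope group_scope.
Implicit Types (g h r s : W) (u v : seq W).

Definition letter_val (l : S * bool) : W := if l.2 then (\val l.1)^-1 else \val l.1.

Lemma eval_word_wprod (u : word S) :
  eval_word (fun s : S => \val s) u = wprod (map letter_val u).
Proof. by rewrite /eval_word /wprod big_map. Qed.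

Lemma coxeter_relator m : has_presentation (fun s : S => \val s) (coxeter_relators m) ->
  forall (i j : S) k, m i j = Some k -> (\val i * \val j) ^+ k = 1.
Proof.
move=> [_ hp] i j k mij.
have /hp : pres_eq (coxeter_relators m) (flatten (nseq k [:: (i, false); (j, false)])) [::].
  rewrite -[X in pres_eq _ X _]cat0s -[X in pres_eq _ (_ ++ X) _]cats0.
  by apply: (@pres_rel _ _ [::] _ [::]); exists i, j, k.
rewrite /eval_word big_nil => <-; elim: k {mij} => [|k IH] /=.
  by rewrite big_nil.
by rewrite !big_cons /= -IH expgS mulgA.
Qed.

Lemma coxeter_sq s : S s -> s * s = 1.
Proof.
case: hS => m [[_ _ m1] hp] Ss; pose i : S := exist _ s (mem_set Ss).
by have := @coxeter_relator m hp i i 1 (proj2 (m1 i i) erefl); rewrite expg1.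
Qed.

Lemma coxeter_invg s : S s -> s^-1 = s.
Proof. by move=> Ss; apply: mulg1_eq; apply: coxeter_sq. Qed.

Lemma coxeter_word g : exists2 u, letters_in S u & g = wprod u.
Proof.
case: hS => m [_ [gen _]]; have [u ->] := gen g.
rewrite eval_word_wprod; exists (map letter_val u) => // _ /mapP[[i b] _ ->].
have Si : S (\val i) by apply: set_mem; apply: valP.
by case: b; rewrite /letter_val //= coxeter_invg.
Qed.

(** The parity of crossings depends only on the group element: a cancelling pair runs along one edge
    and back, and a Coxeter relator meets each wall an even number of times. *)
Lemma pres_eq_odd_refls m (u v : word S) r g :
    has_presentation (fun s : S => \val s) (coxeter_relators m) ->
    pres_eq (coxeter_relators m) u v ->
  odd (count_mem r (refls g (map letter_val u))) =
  odd (count_mem r (refls g (map letter_val v))).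
Proof.
move=> hp; have Sval (i : S) : S (\val i) by apply: set_mem; apply: valP.
(* A closed detour [b] leaves the start of [c] in place, so removing it changes only the crossings
   of [b] itself. *)
have drop_middle (a b c : word S) h : wprod (map letter_val b) = 1 ->
    ~~ odd (count_mem r (refls (h * wprod (map letter_val a)) (map letter_val b))) ->
    odd (count_mem r (refls h (map letter_val (a ++ b ++ c)))) =
    odd (count_mem r (refls h (map letter_val (a ++ c)))).
  move=> b1 /negbTE bev; rewrite !map_cat !refls_cat b1 mulg1 !count_cat !oddD.
  by rewrite bev.
elim=> {u v} [u|u v _ ->|u v w _ -> _ ->|u i b v|u w v [i [j [k [mij ->]]]]] //.
  have lv c : letter_val (i, c) = \val i.
    by case: c; rewrite /letter_val //= coxeter_invg //; apply: Sval.
  apply: drop_middle; rewrite /= !lv.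
    by rewrite !wprod_cons /wprod big_nil mulg1 coxeter_sq //; apply: Sval.
  set h := g * _; rewrite -(mulgA h _ (\val i)) (coxeter_sq (Sval i)).
  by rewrite mulg1 (invgM h) (coxeter_invg (Sval i)) mulgA addn0 addnn odd_double.
have def_w : map letter_val (flatten (nseq k [:: (i, false); (j, false)])) =
    flatten (nseq k [:: \val i; \val j]).
  by rewrite map_flatten map_nseq.
have stk := coxeter_relator hp mij.
apply: drop_middle; rewrite def_w; last first.
  by apply: odd_count_refls_relator => //; apply: coxeter_sq; apply: Sval.
rewrite -[RHS]stk; elim: k {mij def_w stk} => [|k IH] /=.
  by rewrite /wprod big_nil.
by rewrite !wprod_cons IH expgS mulgA.
Qed.

(* [chi] tells the two sides of the wall of [r] apart: it changes exactly along
   the edges of the Cayley graph flipped by [r]. *)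
Definition separates r (chi : W -> bool) := forall g s, S s ->
  chi (g * s) = chi g (+) (g * s * g^-1 == r).

(** The side of [g] is the parity of crossings along a word from 1 to [g]. The word chosen for [g s]
    and the word for [g] followed by [s] spell the same element, hence have equal parity. *)
Lemma wall_sides r : exists chi, separates r chi.
Proof.
case: (hS) => m [_ hp]; case: (hp) => gen eqP'.
have [w def_w] := choice gen.
exists (fun g => odd (count_mem r (refls 1 (map letter_val (w g))))) => g s Ss.
pose i : S := exist _ s (mem_set Ss).
rewrite (@pres_eq_odd_refls m _ (w g ++ [:: (i, false)]))//; last first.
  apply/eqP'; rewrite -def_w /eval_word big_cat big_seq1 /=.
  by rewrite -/(eval_word _ _) -def_w.
rewrite map_cat refls_cat count_cat oddD mul1g -eval_word_wprod -def_w /= addn0.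
by case: eqP.
Qed.

Lemma wall_crossing r chi g u : separates r chi -> letters_in S u ->
  chi (g * wprod u) = chi g (+) odd (count_mem r (refls g u)).
Proof.
move=> chiS; elim: u g => /= [|s u IH] g.
  by rewrite /wprod big_nil mulg1 addbF.
move=> /letters_in_cons[Ss Su]; rewrite wprod_cons mulgA IH// chiS// -addbA.
by rewrite oddD; case: eqP.
Qed.

End Separation.

(** * Convexity of the metric *)

Section PlaneGeometry.
Variable R : realType.
Local Open Scope ring_scope.
Implicit Types p q : R * R.

Lemma plane_distC p q : plane_dist p q = plane_dist q p.
Proof. by rewrite /plane_dist -(sqrrN (p.1 - _)) -(sqrrN (p.2 - _)) !opprB. Qed.

Lemma plane_distxx p : plane_dist p p = 0.
Proof. by rewrite /plane_dist !subrr expr0n addr0 sqrtr0. Qed.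

Lemma plane_dist0 p q : plane_dist p q = 0 -> p = q.
Proof.
case: p q => [p1 p2] [q1 q2] /eqP; rewrite /plane_dist /= sqrtr_eq0 => le0.
have /eqP : (p1 - q1) ^+ 2 + (p2 - q2) ^+ 2 = 0.
  by apply/eqP; rewrite eq_le le0 addr_ge0 ?sqr_ge0.
by rewrite paddr_eq0 ?sqr_ge0// !sqrf_eq0 !subr_eq0 => /andP[/eqP -> /eqP ->].
Qed.

Lemma plane_pointE p q (k : R) :
  plane_point p q (plane_dist p q) (k * plane_dist p q) =
  (p.1 + k * (q.1 - p.1), p.2 + k * (q.2 - p.2)).
Proof.
have [d0|d0] := eqVneq (plane_dist p q) 0.
  by rewrite /plane_point (plane_dist0 d0) !subrr !mulr0.
by rewrite /plane_point mulfK.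
Qed.

Lemma plane_dist_homothety p q q' (k : R) : 0 <= k ->
  plane_dist (p.1 + k * (q.1 - p.1), p.2 + k * (q.2 - p.2))
             (p.1 + k * (q'.1 - p.1), p.2 + k * (q'.2 - p.2)) =
  k * plane_dist q q'.
Proof.
move=> k0; rewrite /plane_dist /=.
rewrite -[k in RHS]ger0_norm// -sqrtr_sqr -sqrtrM ?sqr_ge0//.
by congr Num.sqrt; ring.
Qed.

Lemma comparison_triangle (a b c : R) : 0 <= a -> 0 <= b -> 0 <= c ->
  a <= b + c -> b <= a + c -> c <= a + b ->
  exists p q r, [/\ plane_dist p q = a, plane_dist q r = b & plane_dist p r = c].
Proof.
move=> a0 b0 c0 abc bac cab; have [a_eq0|an0] := eqVneq a 0.
  have bc : b = c by lra.
  exists (0, 0), (0, 0), (c, 0); rewrite plane_distxx /plane_dist /= !sub0r.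
  by rewrite oppr0 expr0n addr0 sqrtr_sqr normrN ger0_norm// a_eq0 bc.
have a_gt0 : 0 < a by rewrite lt_neqAle eq_sym an0.
(* With [p] at the origin and [q] at [(a, 0)], the law of cosines gives the abscissa of [r]. The
   triangle inequalities bound it by [c] in absolute value, so the height is a real square root. *)
pose x := (a ^+ 2 + c ^+ 2 - b ^+ 2) / (2 * a).
have xE : x * (2 * a) = a ^+ 2 + c ^+ 2 - b ^+ 2.
  by rewrite /x divfK// mulf_neq0 ?pnatr_eq0.
have x_le : x <= c.
  by rewrite -(@ler_pM2r _ (2 * a)) ?mulr_gt0// xE; nra.
have x_ge : - c <= x.
  by rewrite -(@ler_pM2r _ (2 * a)) ?mulr_gt0// xE; nra.
have y2_ge0 : 0 <= c ^+ 2 - x ^+ 2 by nra.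
exists (0, 0), (a, 0), (x, Num.sqrt (c ^+ 2 - x ^+ 2)).
rewrite /plane_dist /= !sub0r oppr0 expr0n addr0 !sqrrN sqr_sqrtr//; split.
- by rewrite sqrtr_sqr ger0_norm.
- rewrite -[RHS]ger0_norm// -sqrtr_sqr; congr Num.sqrt.
  have -> : (a - x) ^+ 2 + (c ^+ 2 - x ^+ 2) = a ^+ 2 + c ^+ 2 - x * (2 * a) by ring.
  by rewrite xE; ring.
- by rewrite addrC subrK sqrtr_sqr ger0_norm.
Qed.

End PlaneGeometry.

Section CAT0.
Variables (R : realType) (X : metricType R).
Local Open Scope ring_scope.
Implicit Types (p q : X) (c : R -> X).

Lemma geodesic_rev p q c :
  geodesic p q c -> geodesic q p (fun t => c (mdist p q - t)).
Proof.
case=> c0 c1 cd; rewrite /geodesic (metric_sym q p) /= subr0 subrr; split=> //.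
move=> s t; rewrite !in_itv /= => /andP[s0 s1] /andP[t0 t1].
rewrite cd ?in_itv /= ?subr_ge0 ?lerBlDr ?lerDl ?s0 ?t0 ?s1 ?t1//.
by rewrite -normrN; congr `|_|; ring.
Qed.

Lemma geodesic_sub p q c (s t : R) : geodesic p q c ->
  0 <= s -> s <= t -> t <= mdist p q ->
  mdist (c s) (c t) = t - s /\ geodesic (c s) (c t) (fun u => c (s + u)).
Proof.
case=> c0 c1 cd s0 st t1.
have dst : mdist (c s) (c t) = t - s.
  by rewrite cd ?in_itv /= ?s0 ?(le_trans st) ?(le_trans s0)// distrC ger0_norm ?subr_ge0.
split=> //; rewrite /geodesic dst addr0 addrC subrK; split=> //.
move=> u v; rewrite !in_itv /= => /andP[u0 u1] /andP[v0 v1].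
rewrite cd ?in_itv /= ?addr_ge0//=; try lra.
by rewrite addrAC opprD addrCA addrA; congr `|_|; ring.
Qed.

Hypothesis geodX : geodesic_space X.
Hypothesis catX : cat0_inequality X.

(** In the comparison triangle the two points are the images of [q] and [q'] under the homothety of
    ratio [k] at [p]. *)
Lemma cat0_fan p q q' c c' (k : R) : geodesic p q c -> geodesic p q' c' ->
  0 <= k <= 1 ->
  mdist (c (k * mdist p q)) (c' (k * mdist p q')) <= k * mdist q q'.
Proof.
move=> cpq c'pq' /andP[k0 k1]; have [e eqq'] := geodX q q'.
have [p1 [q1 [q1' [d01 d12 d02]]]] : exists p1 q1 q1' : R * R,
    [/\ plane_dist p1 q1 = mdist p q,
    plane_dist q1 q1' = mdist q q' & plane_dist p1 q1' = mdist p q'].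
  apply: comparison_triangle; rewrite ?mdist_ge0//.
  - by rewrite addrC (metric_sym q q') metric_triangle.
  - by rewrite (metric_sym p q) metric_triangle.
  - exact: metric_triangle.
pose v (i : 'I_3) := nth p [:: p; q; q'] i.
pose v' (i : 'I_3) := nth p1 [:: p1; q1; q1'] i.
(* The sides run cyclically, so the third goes from [q'] back to [p] and is [c'] reversed. *)
pose sides (i : 'I_3) := nth c [:: c; e; fun t => c' (mdist p q' - t)] i.
have := @catX v sides v' _ _ (@Ordinal 3 0 isT) (@Ordinal 3 2 isT)
  (k * mdist p q) (mdist p q' - k * mdist p q').
rewrite /v /v' /sides /= subKr (metric_sym q' p) => h.
have -> : k * mdist q q' = plane_dist
    (plane_point p1 q1 (mdist p q) (k * mdist p q))
    (plane_point q1' p1 (mdist p q') (mdist p q' - k * mdist p q')).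
  rewrite -d12 -(plane_dist_homothety p1)// -d01 -d02 plane_pointE; congr plane_dist.
  have -> (d : R) : d - k * d = (1 - k) * d by ring.
  rewrite (plane_distC p1) plane_pointE.
  by congr pair; ring.
apply: h; rewrite ?in_itv /= ?subr_ge0 ?lerBlDr ?lerDl ?mulr_ge0 ?mdist_ge0//=.
- by case=> [[|[|[|//]]] ?] //=; apply: geodesic_rev.
- case=> [[|[|[|//]]] ?] [[|[|[|//]]] ?] //=;
    by rewrite ?mdistxx ?plane_distxx// plane_distC metric_sym.
- by rewrite ler_piMl ?mdist_ge0.
- by rewrite ler_piMl ?mdist_ge0.
Qed.

(** The diagonal from [p] to [q'] cuts the quadrilateral into two triangles: the fan at [p] gives
    the term in [k], and the fan at [q'], with both geodesics reversed, the term in [1 - k]. *)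
Lemma cat0_convex p q p' q' c c' (k : R) :
  geodesic p q c -> geodesic p' q' c' -> 0 <= k <= 1 ->
  mdist (c (k * mdist p q)) (c' (k * mdist p' q')) <=
  (1 - k) * mdist p p' + k * mdist q q'.
Proof.
move=> cpq c'pq kI; have [e ePQ] := geodX p q'.
apply: le_trans (metric_triangle _ (e (k * mdist p q')) _) _.
rewrite addrC lerD//; last exact: cat0_fan.
have kI' : 0 <= 1 - k <= 1 by lra.
have := cat0_fan (geodesic_rev ePQ) (geodesic_rev c'pq) kI'.
rewrite !(metric_sym q') !mulrBl !mul1r.
by rewrite !(subKr (mdist _ _)).
Qed.

Lemma isometry_geodesic (f : X -> X) p q c :
  (forall y z, mdist (f y) (f z) = mdist y z) -> geodesic p q c ->
  geodesic (f p) (f q) (f \o c).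
Proof.
move=> fI [c0 c1 cd]; rewrite /geodesic fI /= c0 c1; split => // s t sI tI.
by rewrite fI cd.
Qed.

(** Comparing the geodesic with its image under [f] shows that the displacement is convex along it;
    an intermediate value is thus at most the sum of the outer ones. *)
Lemma displacement_le (f : X -> X) p q c (s t u : R) :
  (forall y z, mdist (f y) (f z) = mdist y z) -> geodesic p q c ->
  0 <= s -> s <= t -> t <= u -> u <= mdist p q ->
  mdist (c t) (f (c t)) <= mdist (c s) (f (c s)) + mdist (c u) (f (c u)).
Proof.
move=> fI cpq s0 st tu u1; have su := le_trans st tu.
have [dsu csu] := geodesic_sub cpq s0 su u1.
have [->|sNu] := eqVneq t s; first by rewrite lerDl mdist_ge0.
have u_s : 0 < u - s.
  by rewrite subr_gt0 (lt_le_trans _ tu)// lt_neqAle eq_sym sNu.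
pose k := (t - s) / (u - s).
have kI : 0 <= k <= 1.
  by rewrite /k divr_ge0 ?subr_ge0//= ler_pdivrMr// mul1r lerB.
have := cat0_convex csu (isometry_geodesic fI csu) kI.
rewrite fI dsu /k divfK ?gt_eqF//= addrC subrK -/k => /le_trans; apply.
by apply: lerD; rewrite ler_piMl ?mdist_ge0//; lra.
Qed.

End CAT0.

(** * Quasi-convexity of special subgroups *)

Section Bounds.
Variable R : realType.
Local Open Scope ring_scope.

Lemma finite_set_ubound (T : choiceType) (F : set T) (f : T -> R) :
  finite_set F -> exists2 M, 0 <= M & forall t, F t -> f t <= M.
Proof.
move=> /finite_seqP[s ->]; exists (\sum_(t <- s) `|f t|) => [|t ts].
  by apply: sumr_ge0.
rewrite (le_trans (ler_norm _))// (big_rem t)//= lerDl.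
by apply: sumr_ge0.
Qed.

Lemma compact_mdist_ubound (X : metricType R) (K : set X) (x : X) :
  compact K -> exists2 D, 0 <= D & forall y, K y -> mdist y x <= D.
Proof.
move=> /compact_near_coveringP/(_ R +oo (fun D y => mdist y x <= D)) cK.
have [|D [_ DK]] := cK _; last first.
  exists (Num.max D 0 + 1); first by rewrite addr_ge0// le_max lexx orbT.
  by move=> y Ky; apply: DK => //; rewrite ltr_pwDr// le_max lexx.
(* On the unit ball around [y] every [D] above [mdist y x + 1] is a bound, and compactness makes one
   bound serve all of [K]. *)
move=> y Ky; exists (ball y 1, [set D | mdist y x + 1 < D]) => /=.
  split; first exact: nbhsx_ballx.
  by exists (mdist y x + 1); split; rewrite ?num_real.
move=> [z D] /= [+ /ltW]; rewrite ballEmdist /= => /ltW yz; apply: le_trans.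
by rewrite (le_trans (metric_triangle z y x))// addrC lerD2l metric_sym.
Qed.

End Bounds.

Section GeometricAction.
Variables (R : realType) (W : groupType) (S : set W) (X : metricType R).
Variables (act : W -> X -> X) (x : X).
Local Open Scope ring_scope.
Hypotheses (hS : coxeter_system S) (finS : finite_set S).
Hypotheses (hX : cat0_space X) (hact : geometric_action act).
Implicit Types (g h r : W) (u v : seq W) (y z p q : X) (c : R -> X).

Let act1 y : act 1%g y = y.
Proof. by case: hact => -[]. Qed.

Let actM g h y : act (g * h)%g y = act g (act h y).
Proof. by case: hact => -[]. Qed.

Let act_isom g y z : mdist (act g y) (act g z) = mdist y z.
Proof. by case: hact. Qed.

Lemma orbit_near : exists2 D, 0 <= D & forall y, exists g, mdist y (act g x) <= D.
Proof.
case: hact => _ _ _ [K cK KX]; have [D D0 KD] := compact_mdist_ubound x cK.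
exists D => // y; have [g _ [z Kz <-]] : (\bigcup_(g in setT) (act g @` K)) y.
  by rewrite KX.
by exists g; rewrite act_isom; apply: KD.
Qed.

Lemma finite_displacement (C : R) : finite_set [set g | mdist x (act g x) <= C].
Proof.
case: hX hact => proper _ _ _ [_ _ pd _].
(* The maximum with 0 keeps the centre [x] in the closed ball even when [C] is negative. *)
apply: sub_finite_set (pd _ (proper x (Num.max C 0))) => g /= gC.
exists (act g x); split; last by rewrite /= le_max gC.
by exists x => //=; rewrite mdistxx le_max lexx orbT.
Qed.

Lemma wprod_displacement : exists2 d, 0 <= d & forall u, letters_in S u ->
  mdist x (act (wprod u) x) <= (size u)%:R * d.
Proof.
have [d d0 dS] := finite_set_ubound (fun s => mdist x (act s x)) finS.
exists d => //; elim=> [|s u IH].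
  by rewrite /wprod big_nil act1 mdistxx mul0r.
move=> /letters_in_cons[Ss Su]; rewrite wprod_cons actM.
apply: le_trans (metric_triangle _ (act s x) _) _.
by rewrite act_isom /= -natr1 mulrDl mul1r addrC lerD// ?IH// dS.
Qed.

Lemma displacement_near r y g (D : R) : mdist y (act g x) <= D ->
  mdist y (act r y) <= 2 * D + mdist (act g x) (act (r * g)%g x).
Proof.
move=> yg; apply: le_trans (metric_triangle _ (act g x) _) _.
have := metric_triangle (act g x) (act (r * g)%g x) (act r y).
by rewrite {2}actM act_isom (metric_sym (act g x) y); lra.
Qed.

(** A word of bounded length leads from [g] to [h] and must cross the wall of [r]. So [r] flips an
    edge at bounded word distance from [g], hence moves [act g x], and with it [y], by a bounded
    amount. *)
Lemma displacement_crossing (D : R) : exists2 C, 0 <= C &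
  forall r chi y z g h, separates S r chi -> mdist y z <= 1 ->
    mdist y (act g x) <= D -> mdist z (act h x) <= D -> chi g != chi h ->
  mdist y (act r y) <= C.
Proof.
have [d d0 dS] := wprod_displacement.
pose word g := projT1 (cid2 (coxeter_word hS g)).
have wordS g : letters_in S (word g) by rewrite /word; case: cid2.
have wordE g : g = wprod (word g) by rewrite /word; case: cid2.
(* The element [g^-1 h] moves [x] by at most [D + 1 + D], so finitely many elements occur and [M]
   bounds their words. *)
have [M M0 MF] := finite_set_ubound (fun g => (size (word g))%:R : R)
  (finite_displacement (2 * D + 1)).
exists (2 * `|D| + 2 * M * d); first by rewrite addr_ge0// !mulr_ge0.
move=> r chi y z g h chiS yz yg zh; apply: contraNT; rewrite -ltNge => big.
have := MF (g^-1 * h)%g; rewrite /= -(act_isom g) -actM mulVKg => /(_ _) size_le.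
have {}size_le : (size (word (g^-1 * h)%g))%:R <= M.
  apply: size_le; apply: le_trans (metric_triangle _ y _) _.
  by have := metric_triangle y z (act h x); rewrite (metric_sym _ y); lra.
rewrite -{1}(mulVKg g h) [X in (g * X)%g]wordE (wall_crossing _ chiS)//.
set u := word _ in size_le *; have Su : letters_in S u by apply: wordS.
suff /count_memPn -> : r \notin refls g u by rewrite addbF.
apply/negP => /refls_prefix[p [s [q [def_u def_r]]]].
have S_sq := coxeter_sq hS.
have Sp : letters_in S p by move=> t tp; apply: Su; rewrite def_u mem_cat tp.
have Ss : S s by apply: Su; rewrite def_u mem_cat mem_head orbT.
(* Go out to the flipped edge, cross it and come back mirrored: the length [2|p| + 1] is at most
   [2|u|]. *)
have def_rg : (r * g = g * wprod (p ++ s :: rev p))%g.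
  by rewrite def_r wprod_cat wprod_cons (wprod_rev S_sq)// invgM !mulgA mulgVK.
have := displacement_near r yg; rewrite def_rg actM act_isom.
have : letters_in S (p ++ s :: rev p).
  apply: letters_in_cat => //; apply/letters_in_cons; split=> // t.
  by rewrite mem_rev; apply: Sp.
move=> /dS; set n := size _ => le_nd.
have le_n2M : n%:R * d <= 2 * M * d.
  apply: ler_wpM2r => //; apply: le_trans (_ : 2 * (size u)%:R <= _).
    rewrite -natrM ler_nat /n def_u !size_cat /= size_rev; lia.
  by rewrite ler_wpM2l.
by have := ler_norm D; lra.
Qed.

(** Follow the geodesic in unit steps, with an orbit point near each. Somewhere consecutive orbit
    points lie on different sides, and [step] applies there; the induction is on an integer bound
    for [t - s]. *)
Lemma displacement_geodesic (D C : R) r chi p q c : separates S r chi ->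
    (forall y, exists g, mdist y (act g x) <= D) ->
    (forall y z g h, mdist y z <= 1 ->
       mdist y (act g x) <= D -> mdist z (act h x) <= D -> chi g != chi h ->
     mdist y (act r y) <= C) ->
    geodesic p q c -> forall (s t : R) g h, 0 <= s -> s <= t -> t <= mdist p q ->
    mdist (c s) (act g x) <= D -> mdist (c t) (act h x) <= D ->
    chi g != chi h ->
  exists w, [/\ s <= w, w <= t & mdist (c w) (act r (c w)) <= C].
Proof.
move=> chiS near step cpq s t.
have [n] : exists n, t - s <= n%:R :> R.
  by exists (Num.bound `|t - s|); rewrite (le_trans (ler_norm _))// ltW// archi_boundP.
elim: n s => [|n IH] s ts_n g h s0 st t1 sg th gh.
  exists s; split=> //; apply: (step _ _ _ _ _ sg th gh).
  by have -> : t = s; [lra|rewrite mdistxx].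
have [ts1|ts1] := leP (t - s) 1.
  exists s; split=> //; apply: (step _ _ _ _ _ sg th gh).
  by have [-> _] := geodesic_sub cpq s0 st t1.
have s1 : s <= s + 1 by lra.
have s1t : s + 1 <= t by lra.
have [g' s1g'] := near (c (s + 1)).
have [gg'|gg'] := eqVneq (chi g) (chi g'); last first.
  exists s; split=> //; apply: (step _ _ _ _ _ sg s1g' gg').
  by have [-> _] := geodesic_sub cpq s0 s1 (le_trans s1t t1); lra.
have [||w [sw wt Cw]] := IH (s + 1) _ g' h (le_trans s0 s1) s1t t1 s1g' th.
- by rewrite -natr1 in ts_n; lra.
- by rewrite -gg'.
- by exists w; split=> //; lra.
Qed.

(* The condition on all [v] says that [u] is a shortest word in its coset
   [<A> (wprod u)]. *)
Lemma minimal_coset_word (A : set W) (D : R) : 0 <= D -> A `<=` S ->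
    (forall y, exists g, mdist y (act g x) <= D) ->
  exists N : nat, forall u a1 a2 c t, letters_in S u ->
    (forall v, letters_in S v -> generated A (wprod v * (wprod u)^-1)%g ->
       (size u <= size v)%N) ->
    generated A a1 -> generated A a2 ->
    geodesic (act a1 x) (act a2 x) c ->
    0 <= t -> t <= mdist (act a1 x) (act a2 x) ->
    mdist (c t) (act (wprod u) x) <= D ->
  (size u <= N)%N.
Proof.
move=> D0 AS near; have [C C0 crossC] := displacement_crossing D.
have S_sq := coxeter_sq hS; have sA := @generated_subgroup W A.
have [f def_f] := (finite_seqP _).1 (finite_displacement (2 * D + 2 * C)).
(* The list [f] contains every element moving [x] by at most [2D + 2C]; the distinct conjugates
   [b^-1 r b], one per letter of [u], will all be found in it. *)
exists (size f) => u a1 a2 c t Su minu Aa1 Aa2 ca t0 t1 ctu.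
set b := wprod u in minu ctu *.
have uniq_refls : uniq (refls 1%g u).
  apply: (refls_uniq S_sq) => // v Sv vu; apply: minu => //.
  by rewrite vu mulgV; apply: subgroup_set1.
rewrite -(size_refls 1 u) -(size_map (fun r => b^-1 * r * b)%g).
apply: uniq_leq_size.
  by rewrite map_inj_uniq// => r1 r2 /mulIg/mulgI.
move=> _ /mapP[r ru ->].
(* The wall of [r] has the whole of <A> on one side and [b] on the other. *)
have rNA : ~ generated A r.
  move=> Ar; have [v [Sv vu]] := refls_delete S_sq Su ru.
  rewrite !mul1g => def_v; have := minu v Sv; rewrite -def_v mulgK => /(_ Ar).
  by rewrite leqNgt vu.
have [chi chiS] := wall_sides hS r.
(* As [refls 1 u] has no repetition, [u] crosses this wall exactly once. *)
have chib : chi b = ~~ chi 1%g.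
  by rewrite -[b]mul1g (wall_crossing _ chiS Su) count_uniq_mem ?ru ?addbT.
have chiA a : generated A a -> chi a = chi 1%g.
  move=> /(generated_word S_sq AS)[v Av ->].
  have Sv : letters_in S v by move=> s /Av/AS.
  rewrite -[wprod v]mul1g (wall_crossing _ chiS Sv).
  have /count_memPn -> : r \notin refls 1%g v; last by rewrite addbF.
  apply/negP => /(subgroup_refls sA (subgroup_set1 sA)) Ar; apply: rNA; apply: Ar.
  by move=> s /Av; apply: sub_gen_smallest.
have step y z g h : mdist y z <= 1 ->
     mdist y (act g x) <= D -> mdist z (act h x) <= D -> chi g != chi h ->
     mdist y (act r y) <= C by exact: crossC.
have [c0 cL _] := ca.
(* The wall separates [b] from both [a1] and [a2], so [r] has displacement at most [C] at some time
   before [t] and at some time after it; by convexity it is at most [2C] at [t]. *)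
have [||w1 [w10 w1t Cw1]] := displacement_geodesic chiS near step ca
  (g := a1) (h := b) (lexx 0) t0 t1 _ ctu.
- by rewrite c0 mdistxx.
- by rewrite chib chiA//; case: (chi _).
have [||w2 [tw2 w2L Cw2]] := displacement_geodesic chiS near step ca
  (g := b) (h := a2) t0 t1 (lexx _) ctu _ _.
- by rewrite cL mdistxx.
- by rewrite chib chiA//; case: (chi _).
have [_ _ geodX catX] := hX.
have Cct := displacement_le geodX catX (act_isom r) ca w10 w1t tw2 w2L.
suff : [set g | mdist x (act g x) <= 2 * D + 2 * C] (b^-1 * r * b)%g by rewrite def_f.
rewrite /= -(act_isom b) -actM !mulgA mulgV mul1g.
have := metric_triangle (act b x) (c t) (act (r * b)%g x).
have := metric_triangle (c t) (act r (c t)) (act (r * b)%g x).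
by rewrite actM act_isom (metric_sym (act b x) (c t)); lra.
Qed.

End GeometricAction.

Theorem corollary6p5 (R : realType) (W : groupType) (S : set W)
    (X : metricType R) (act : W -> X -> X) (x : X) (P : (W -> R) -> X)
    (hWS : coxeter_system S) (hfin : finite_set S)
    (hX : cat0_space X) (hact : geometric_action act)
    (hP : cayley_copy_map act S x P)
    (A : set W) (hA : A `<=` S) :
  quasi_convex (P @` (@vertex R W @` generated A)).
Proof.
have [D D0 near] := orbit_near x hact.
have [d d0 dS] := wprod_displacement x hfin hact.
have [N boundN] := minimal_coset_word hWS hfin hX hact D0 hA near.
have [[act1 actM] act_isom _ _] := hact; have [_ _ Pv _] := hP.
have sA := @generated_subgroup W A.
(* [D] leads from the geodesic to the orbit and [N d] from there to the orbit of the subgroup; the 1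
   is added because balls are open. *)
exists (N%:R * d + D + 1)%R.
move=> _ _ c [_ [a1 Aa1 <-] <-] [_ [a2 Aa2 <-] <-]; rewrite !Pv => ca y.
case=> t; rewrite /= in_itv /= => /andP[t0 t1] <-; have [g gD] := near (c t).
(* The lengths of words for elements of the right coset of [g]. A shortest one spells [b], with
   [g = a b] and [a] in the subgroup. *)
pose inCoset n := `[< exists u,
  [/\ letters_in S u, size u = n & generated A (g * (wprod u)^-1)%g] >].
have ex_word : exists n, inCoset n.
  have [u Su def_g] := coxeter_word hWS g; exists (size u).
  apply/asboolP; exists u; split=> //; rewrite -def_g mulgV.
  exact: subgroup_set1.
have [n /asboolP[u [Su <- Aa]] minn] := ex_minnP ex_word.
set b := wprod u in Aa *; set a := (g * b^-1)%g in Aa *.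
have uN : (size u <= N)%N.
  have AaV := subgroup_setV sA Aa.
  (* Translating by [a^-1] keeps the endpoints in the orbit of the subgroup and takes [act g x] to
     [act b x]. *)
  have := isometry_geodesic (act_isom a^-1%g) ca; rewrite -!actM => ca'.
  apply: (boundN u _ _ _ t Su _ (subgroup_setM sA AaV Aa1) (subgroup_setM sA AaV Aa2) ca' t0).
  - move=> v Sv Av; apply: minn; apply/asboolP; exists v; split=> //.
    have -> : (g * (wprod v)^-1 = a * (wprod v * b^-1)^-1)%g.
      by rewrite invgM invgK /a mulgA mulgVK.
    exact: (subgroup_setM sA Aa (subgroup_setV sA Av)).
  - by rewrite !actM act_isom.
  - by rewrite /= -(act_isom a) -!actM mulgV act1 /a mulgVK.
exists (act a x); first by exists (vertex R a) => //; exists a.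
rewrite ballEmdist /=; have := metric_triangle (act a x) (act g x) (c t).
have -> : mdist (act a x) (act g x) = mdist x (act b x).
  by rewrite -(act_isom a x) -actM /a mulgVK.
have := dS u Su; rewrite (metric_sym (act g x)).
have : ((size u)%:R * d <= N%:R * d)%R by rewrite ler_wpM2r// ler_nat.
by rewrite -/b; lra.
Qed.
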